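(* Consider an irreducible continuous-time Markov chain on a finite set $V$ with jump rates $R$, stationary probability $\pi$ and Donsker–Varadhan rate functional $\mathscr I$. Fix a probability measure $\mu$ on $V$ with $\mu(x)>0$ for all $x\in V$, and a function $f:V\to\mathbb R$ with $\sum_{x}\mu(x)f(x)=0$. Let $\nu(x)=\mu(x)f(x)$ and $\mu_\epsilon=\mu+\epsilon\nu=\mu(1+\epsilon f)$ for $\epsilon>0$. Then the functional derivative $\frac{\delta\mathscr I}{\delta\mu}(\mu;\nu):=\lim_{\epsilon\to0}\frac1\epsilon\{\mathscr I(\mu+\epsilon\nu)-\mathscr I(\mu)\}$ exists and $$\frac{\delta\mathscr I}{\delta\mu}(\mu;\nu)=\sum_{x,y\in V}\nu(x)R(x,y)\big[1-e^{H_\mu(y)-H_\mu(x)}\big].$$ In particular, as $H_\pi=0$ (up to an additive constant), $\frac{\delta\mathscr I}{\delta\mu}(\pi;\nu)=0$ for all $\nu:V\to\mathbb R$ with $\sum_x\nu(x)=0$.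
   Context: The generator is $(\mathscr Lf)(x)=\sum_yR(x,y)[f(y)-f(x)]$. For a probability measure $\mu$ on $V$, $\mathscr I(\mu)=\sup_{H:V\to\mathbb R}\mathscr J_H(\mu)$, where $\mathscr J_H(\mu)=-\sum_x\mu(x)e^{-H(x)}(\mathscr Le^H)(x)=\sum_{x,y}\mu(x)R(x,y)[1-e^{H(y)-H(x)}]$. Known fact: if the chain is irreducible and $\mu(x)>0$ for all $x$, there is a function $H_\mu:V\to\mathbb R$, unique up to an additive constant, such that $\mathscr I(\mu)=\mathscr J_{H_\mu}(\mu)$; this defines $H_\mu$. *)

(* Defs.v *)
From HB Require Import structures.
From mathcomp Require Import all_boot all_order all_algebra.
From mathcomp Require Import all_classical all_reals all_analysis.

Set Implicit Arguments.
Unset Strict Implicit.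
Unset Printing Implicit Defensive.

Import Order.TTheory GRing.Theory Num.Theory.
Import numFieldNormedType.Exports.

Local Open Scope classical_set_scope.
Local Open Scope ring_scope.

Section DonskerVaradhan.
Context {R : realType} {V : finType}.
Implicit Types (r : V -> V -> R) (mu nu f H : V -> R).

(* The diagonal of r is left unconstrained: it plays no role in the generator
   nor in irreducibility. *)
Definition jump_rates r := forall x y, x != y -> 0 <= r x y.

Definition irreducible_rates r :=
  forall x y, connect (fun a b => 0 < r a b) x y.

Definition generator r f : V -> R :=
  fun x => \sum_y r x y * (f y - f x).

Definition is_prob mu := (forall x, 0 <= mu x) /\ \sum_x mu x = 1.

Definition stationary r mu := forall f, \sum_x mu x * generator r f x = 0.

Definition DV_J r H mu : R :=
  - \sum_x mu x * expR (- H x) * generator r (fun y => expR (H y)) x.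

(* For mu >= 0 the set is nonempty and bounded above by
   \sum_(x, y | x != y) mu x * r x y, so the real-valued sup is the true
   supremum. *)
Definition DV_I r mu : R := sup [set DV_J r H mu | H in [set: V -> R]].

(* A maximizer of H |-> DV_J r H mu. If r is irreducible and mu > 0, one exists
   and it is unique up to an additive constant; xget selects one of them, and
   its default value is then irrelevant. *)
Definition DV_H r mu : V -> R :=
  xget (fun=> 0) [set H | DV_I r mu = DV_J r H mu].

(* One-sided limit: eps > 0. *)
Definition DV_I_derivative r mu nu (l : R) :=
  eps^-1 * (DV_I r (fun x => mu x + eps * nu x) - DV_I r mu)
    @[eps --> 0^'+] --> l.

End DonskerVaradhan.

(* Main.v *)
Require Import Defs.
From HB Require Import structures.
From mathcomp Require Import all_boot all_order all_algebra.
From mathcomp Require Import all_classical all_reals all_analysis.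
From mathcomp Require Import ring lra.

Set Implicit Arguments.
Unset Strict Implicit.
Unset Printing Implicit Defensive.

Import Order.TTheory GRing.Theory Num.Theory.
Import numFieldNormedType.Exports.

Local Open Scope classical_set_scope.
Local Open Scope ring_scope.

(* Let H0 maximize H |-> J_H(mu) and let w(x,y) = mu(x) r(x,y) e^{H0(y)-H0(x)}.
   The first-order condition at H0 says that the flow w is balanced, so
   sum w(x,y) (K(y) - K(x)) = 0 for every K. With K = H - H0 and
   d = K(y) - K(x) this gives, for every H,
     J_H(mu + eps nu) = J_H0(mu) + eps J_H0(nu)
                        - sum w(x,y) [(1 + eps f(x)) (e^d - 1) - d],
   and minimizing the bracket over d bounds it below by -2 eps^2 f(x)^2,
   uniformly in H. Together with the trivial bound
   I(mu + eps nu) >= J_H0(mu + eps nu), this squeezes the difference quotient. *)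

Section RateFunctional.
Context {R : realType} {V : finType}.
Implicit Types (r : V -> V -> R) (mu nu f H K : V -> R).

(** * Algebra of $J_H$ *)

Lemma DV_JE r H mu :
  DV_J r H mu = \sum_x \sum_y mu x * r x y * (1 - expR (H y - H x)).
Proof.
rewrite /DV_J -sumrN; apply: eq_bigr => x _.
rewrite /generator mulr_sumr -sumrN; apply: eq_bigr => y _.
rewrite expRD !expRN; field.
by rewrite gt_eqF ?expR_gt0.
Qed.

Lemma DV_JD r H mu nu (e : R) :
  DV_J r H (fun x => mu x + e * nu x) = DV_J r H mu + e * DV_J r H nu.
Proof.
rewrite !DV_JE mulr_sumr -big_split; apply: eq_bigr => x _ /=.
by rewrite mulr_sumr -big_split; apply: eq_bigr => y _ /=; ring.
Qed.

Lemma DV_J_shift r H mu (c : R) : DV_J r (fun x => H x - c) mu = DV_J r H mu.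
Proof.
rewrite !DV_JE; apply: eq_bigr => x _; apply: eq_bigr => y _.
by congr (_ * (1 - expR _)); ring.
Qed.

Lemma DV_J_cst r mu (c : R) : DV_J r (fun=> c) mu = 0.
Proof.
rewrite DV_JE big1// => x _; rewrite big1// => y _.
by rewrite subrr expR0 subrr mulr0.
Qed.

(** * Existence of a maximizer of $H \mapsto J_H(\mu)$ *)

Lemma edge_increment_bounded r mu a b :
  jump_rates r -> (forall x, 0 < mu x) -> 0 < r a b ->
  exists C, forall H, 0 <= DV_J r H mu -> H b - H a <= C.
Proof.
move=> r_ge0 mu_gt0 rab.
pose S := \sum_(q : V * V) `|mu q.1 * r q.1 q.2|.
(* With m = [mu a * r a b] and d = [H b - H a], the condition J >= 0 gives m (e^d - 1) <= S, and d
   <= e^d. The absolute values in [S] absorb diagonal rates of unknown sign. *)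
exists ((mu a * r a b)^-1 * (mu a * r a b + S)) => H.
have m_gt0 : 0 < mu a * r a b by rewrite mulr_gt0.
rewrite DV_JE pair_bigA (bigD1 (a, b))//= => J_ge0.
set T := \sum_(i | _) _ in J_ge0.
have TS : T <= S.
  rewrite /S (bigD1 (a, b))//= -[leLHS]add0r lerD// ler_sum// => -[x y] _ /=.
  have [<-|xy] := eqVneq x y; first by rewrite subrr expR0 subrr mulr0.
  have m_ge0 : 0 <= mu x * r x y by apply: mulr_ge0; [exact: ltW|exact: r_ge0].
  by rewrite ger0_norm// ler_piMr// gerBl expR_ge0.
rewrite ler_pdivlMl//.
have := expR_ge1Dx (H b - H a).
rewrite -(ler_pM2l m_gt0); nra.
Qed.

Lemma increment_bounded r mu a b :
  jump_rates r -> (forall x, 0 < mu x) -> connect (fun x y => 0 < r x y) a b ->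
  exists C, forall H, 0 <= DV_J r H mu -> H b - H a <= C.
Proof.
move=> r_ge0 mu_gt0 /connectP[s + ->]; elim: s a => [|c s IHs] a /=.
  by exists 0 => H _; rewrite subrr.
move=> /andP[rac /IHs[C HC]].
have [D HD] := edge_increment_bounded r_ge0 mu_gt0 rac.
(* Increments telescope along the path. *)
exists (C + D) => H J_ge0.
by rewrite -(subrKA (H c)) lerD ?HC ?HD.
Qed.

Import ArrowAsProduct.

Lemma DV_J_continuous r mu : continuous (fun H : V -> R => DV_J r H mu).
Proof.
have coordB x y : continuous (fun H : V -> R => H y - H x).
  move=> H; apply: (@cvgB R R _ (nbhs H)); exact: (@proj_continuous V (fun=> R)).
have expB (m : R) : continuous (fun t : R => m * (1 - expR t)).
  move=> t; apply: cvgMl_tmp; apply: cvgB; first exact: cvg_cst.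
  exact: continuous_expR.
have sumC (F : V -> (V -> R) -> R) : (forall x, predT x -> continuous (F x)) ->
    continuous (fun H : V -> R => \sum_x F x H).
  exact: (@continuous_big R V +%R 0 predT add_continuous _ (index_enum V) F).
have -> : (fun H : V -> R => DV_J r H mu) = (fun H : V -> R =>
    \sum_x \sum_y mu x * r x y * (1 - expR (H y - H x))).
  by apply/funext => H; rewrite DV_JE.
apply: (sumC) => x _; apply: (sumC) => y _ H.
exact: (@continuous_comp _ R R (fun H : V -> R => H y - H x)
  (fun t => mu x * r x y * (1 - expR t)) H (@coordB x y H) (expB _ _)).
Qed.

(* Normalizing H(x0) = 0, the set where J >= 0 = J_0 lies in a compact box. *)
Lemma DV_J_max r mu :
  jump_rates r -> irreducible_rates r -> (forall x, 0 < mu x) ->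
  exists H0, forall H, DV_J r H mu <= DV_J r H0 mu.
Proof.
move=> r_ge0 r_irr mu_gt0.
have [x0 _|V0] := pickP (@predT V); last first.
  by exists (fun=> 0) => H; rewrite !DV_JE !big_pred0.
have /choice[C HC] (q : V * V) : exists C, forall H, 0 <= DV_J r H mu ->
    H q.2 - H q.1 <= C.
  exact: (increment_bounded r_ge0 mu_gt0 (r_irr q.1 q.2)).
pose A : set (V -> R) :=
  [set H | forall x, `[- C (x, x0), C (x0, x)]%classic (H x)].
have compA : compact A.
  apply: (@tychonoff V (fun=> R) (fun x => `[- C (x, x0), C (x0, x)]%classic)).
  by move=> x; exact: segment_compact.
have normA H : 0 <= DV_J r H mu -> A (fun x => H x - H x0).
  move=> J_ge0 x /=; rewrite in_itv/= (HC (x0, x) H)// andbT.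
  by rewrite lerNl opprB (HC (x, x0) H).
have A0 : A !=set0 by eexists; apply: (normA (fun=> 0)); rewrite DV_J_cst.
have [H0 _ maxH0] := compact_EVT_max A0 compA
  (continuous_subspaceT (@DV_J_continuous r mu)).
exists H0 => H; have [J_ge0|/ltW J_le0] := leP 0 (DV_J r H mu).
  by rewrite -(DV_J_shift r H mu (H x0)) maxH0// inE; exact: normA.
apply: le_trans J_le0 _.
(* Where J is negative, the zero function does better; it is written [0 - 0] to match [normA] at
   [fun=> 0]. *)
rewrite -(DV_J_cst r mu (0 - 0)) maxH0// inE.
by apply: (normA (fun=> 0)); rewrite DV_J_cst.
Qed.

Lemma DV_I_max r mu H0 :
  (forall H, DV_J r H mu <= DV_J r H0 mu) -> DV_I r mu = DV_J r H0 mu.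
Proof.
move=> H0_max; apply/eqP; rewrite eq_le; apply/andP; split.
  by apply: ge_sup; [exists (DV_J r H0 mu), H0|move=> _ [H _ <-]].
apply: ub_le_sup; last by exists H0.
by exists (DV_J r H0 mu) => _ [H _ <-].
Qed.

Lemma DV_H_max r mu H :
  jump_rates r -> irreducible_rates r -> (forall x, 0 < mu x) ->
  DV_J r H mu <= DV_J r (DV_H r mu) mu.
Proof.
move=> r_ge0 r_irr mu_gt0; have [H0 H0_max] := DV_J_max r_ge0 r_irr mu_gt0.
have <- : DV_I r mu = DV_J r (DV_H r mu) mu.
  apply: (@xgetPex _ _ [set H | DV_I r mu = DV_J r H mu]).
  by exists H0; exact: DV_I_max.
by rewrite (DV_I_max H0_max).
Qed.

(** * First-order condition at a maximizer *)

Definition tilt r mu H x y := mu x * r x y * expR (H y - H x).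

Lemma tilt_ge0 r mu H x y :
  jump_rates r -> (forall z, 0 <= mu z) -> x != y -> 0 <= tilt r mu H x y.
Proof.
by move=> r_ge0 mu_ge0 xy; rewrite /tilt !mulr_ge0 ?expR_ge0 ?mu_ge0 ?r_ge0.
Qed.

(** From e^(-s) >= 1 - s one gets (1 - s) e^s <= 1, while (1 - s)(1 + s + 2 s^2) = 1 + s^2 (1 - 2 s)
    >= 1. *)
Lemma expR_le1DxX2 (s : R) : `|s| <= 2^-1 -> expR s - 1 <= s + 2 * s ^+ 2.
Proof.
rewrite ler_norml => /andP[s1 s2]; have E0 := expR_gt0 s.
have := expR_ge1Dx (- s); rewrite expRN -(ler_pM2r E0) mulVf ?gt_eqF// => E1.
have : 0 <= s ^+ 2 * (1 - 2 * s) by rewrite mulr_ge0 ?sqr_ge0//; lra.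
move=> s3; have : 0 <= (1 - s) * (s + 2 * s ^+ 2 - (expR s - 1)) by nra.
by rewrite pmulr_rge0 ?subr_ge0//; lra.
Qed.

Lemma ler_norm_sum2 (F : V -> V -> R) x y :
  `|F x y| <= \sum_x \sum_y `|F x y|.
Proof.
rewrite (bigD1 x)//= (bigD1 y)//= -addrA lerDl addr_ge0//.
  by rewrite sumr_ge0.
by rewrite sumr_ge0// => z _; rewrite sumr_ge0.
Qed.

(** Stationarity of [mu] for the tilted rates. Comparing [H0] with [H0 + t K] gives 0 <= t S + t^2 Q
    for all small t of either sign, which forces S = 0 without differentiating. *)
Lemma tilt_balanced r mu H0 K :
  jump_rates r -> (forall x, 0 <= mu x) ->
  (forall H, DV_J r H mu <= DV_J r H0 mu) ->
  \sum_x \sum_y tilt r mu H0 x y * (K y - K x) = 0.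
Proof.
move=> r_ge0 mu_ge0 H0_max; set S := LHS.
pose Q := \sum_x \sum_y 2 * (tilt r mu H0 x y * (K y - K x) ^+ 2).
pose M := \sum_x \sum_y `|K y - K x|.
have quad t : `|t| * M <= 2^-1 -> 0 <= t * S + t ^+ 2 * Q.
  move=> tM; have := H0_max (fun x => H0 x + t * K x).
  rewrite -subr_ge0 => /le_trans; apply; rewrite !DV_JE -sumrB.
  rewrite /S /Q !mulr_sumr -big_split ler_sum//= => x _.
  rewrite -sumrB !mulr_sumr -big_split ler_sum//= => y _.
  have -> : H0 y + t * K y - (H0 x + t * K x) = (H0 y - H0 x) + t * (K y - K x).
    by ring.
  have [<-|xy] := eqVneq x y.
    by rewrite !subrr !mulr0 addr0 expR0 subrr expr0n/= !mulr0 addr0.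
  have := tilt_ge0 H0 r_ge0 mu_ge0 xy.
  rewrite (expRD (H0 y - H0 x)) /tilt; set W := (X in 0 <= X) => W_ge0.
  have /expR_le1DxX2 : `|t * (K y - K x)| <= 2^-1.
    rewrite normrM (le_trans _ tM)// ler_wpM2l//.
    exact: (@ler_norm_sum2 (fun x y => K y - K x)).
  move=> /(ler_wpM2l W_ge0); rewrite -subr_ge0 -[X in _ -> is_true X]subr_ge0.
  by rewrite /W; congr (0 <= _); ring.
apply/eqP/negPn/negP => S_neq0.
have M_ge0 : 0 <= M by rewrite sumr_ge0// => x _; rewrite sumr_ge0.
pose D := 2 * (1 + `|S| * M + `|Q|).
have SM_ge0 : 0 <= `|S| * M by rewrite mulr_ge0.
have Q_ge0 : 0 <= `|Q| by [].
have D_gt0 : 0 < D by rewrite /D; lra.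
have S2_gt0 : 0 < S ^+ 2 by rewrite exprn_even_gt0.
(* This t has the sign opposite to [S]; [D] is large enough that t is admissible and that [Q < D],
   so the quadratic is negative. *)
have := quad (- S / D); rewrite normrM normrN normfV (gtr0_norm D_gt0).
rewrite mulrAC ler_pdivrMr// => /(_ _)/wrap[]; first by rewrite /D; lra.
have -> : - S / D * S + (- S / D) ^+ 2 * Q = S ^+ 2 * (D^-1) ^+ 2 * (Q - D).
  by field; rewrite gt_eqF.
rewrite pmulr_rge0; last by rewrite (pmulr_rgt0 _ S2_gt0) exprn_gt0 ?invr_gt0.
have := ler_norm Q; rewrite /D; lra.
Qed.

(** * Second-order bound and the one-sided derivative *)

(* The minimum over d is at e^d = 1 / (1 + a). *)
Lemma expR_sub_ge (a d : R) : `|a| <= 2^-1 ->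
  0 <= (1 + a) * (expR d - 1) - d + 2 * a ^+ 2.
Proof.
rewrite ler_norml => /andP[a1 a2]; set u := 1 + a.
have u_gt0 : 0 < u by rewrite /u; lra.
(* Adding the two tangent bounds cancels [ln u] and leaves the lower bound 2 - u - 1/u = - a^2 /
   u. *)
have := expR_ge1Dx (d + ln u); have := expR_ge1Dx (- ln u).
rewrite expRD expRN lnK ?posrE// => lnu Ed.
have uV : u * u^-1 = 1 by rewrite mulfV ?gt_eqF.
have V2 : u^-1 <= 2 by rewrite -(ler_pM2l u_gt0) uV /u; lra.
have : 0 <= a ^+ 2 * (2 - u^-1) by rewrite mulr_ge0 ?sqr_ge0 ?subr_ge0.
have -> : a ^+ 2 * (2 - u^-1) = 2 * a ^+ 2 + 2 - u^-1 - u.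
  have -> : a = u - 1 by rewrite /u; ring.
  by field; rewrite gt_eqF.
lra.
Qed.

Lemma DV_J_perturb r mu f H0 (e : R) H :
  jump_rates r -> (forall x, 0 <= mu x) ->
  (forall H, DV_J r H mu <= DV_J r H0 mu) ->
  (forall x, `|e * f x| <= 2^-1) ->
  DV_J r H (fun x => mu x + e * (mu x * f x)) <=
  DV_J r H0 mu + e * DV_J r H0 (fun x => mu x * f x) +
  e ^+ 2 * \sum_x \sum_y 2 * `|tilt r mu H0 x y| * f x ^+ 2.
Proof.
move=> r_ge0 mu_ge0 H0_max ef.
have bal := tilt_balanced (fun x => H x - H0 x) r_ge0 mu_ge0 H0_max.
(* Inserting the vanishing balance sum makes the inequality hold for each pair (x, y) separately. *)
rewrite -DV_JD -[X in X + _]subr0 -[X in _ - X]bal !DV_JE -sumrB.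
rewrite mulr_sumr -big_split; apply: ler_sum => x _ /=; rewrite -sumrB mulr_sumr -big_split.
apply: ler_sum => y _ /=.
have [<-|xy] := eqVneq x y.
  rewrite !subrr expR0 subrr !mulr0 subrr add0r.
  by apply: mulr_ge0; rewrite ?sqr_ge0//; apply: mulr_ge0; rewrite ?sqr_ge0.
have W_ge0 := tilt_ge0 H0 r_ge0 mu_ge0 xy; rewrite (ger0_norm W_ge0).
rewrite -subr_ge0.
have -> : H y - H x = (H0 y - H0 x) + ((H y - H0 y) - (H x - H0 x)) by ring.
have := mulr_ge0 W_ge0 (expR_sub_ge ((H y - H0 y) - (H x - H0 x)) (ef x)).
by rewrite (expRD (H0 y - H0 x)) /tilt; congr (0 <= _); ring.
Qed.

Lemma squeeze_affine_right (g : R -> R) (L C : R) :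
  (\forall e \near 0^'+, L <= g e <= L + e * C) -> g e @[e --> 0^'+] --> L.
Proof.
move=> gL; apply: (squeeze_cvgr gL); first exact: cvg_cst.
have : L + e * C @[e --> 0^'+] --> L + 0 * C.
  apply: cvg_at_right_filter; apply: cvgD; first exact: cvg_cst.
  by apply: cvgMr_tmp; exact: cvg_id.
by rewrite mul0r addr0.
Qed.

Lemma DV_I_derivativeE r mu f H0 :
  jump_rates r -> (forall x, 0 <= mu x) ->
  (forall H, DV_J r H mu <= DV_J r H0 mu) ->
  DV_I_derivative r mu (fun x => mu x * f x)
    (DV_J r H0 (fun x => mu x * f x)).
Proof.
move=> r_ge0 mu_ge0 H0_max; rewrite /DV_I_derivative (DV_I_max H0_max).
set L := DV_J r H0 (fun x => _).
pose C := \sum_x \sum_y 2 * `|tilt r mu H0 x y| * f x ^+ 2.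
pose F := \sum_x `|f x|.
have F_ge0 : 0 <= F by rewrite sumr_ge0.
apply: (@squeeze_affine_right _ _ C).
(* Below this threshold [|e * f x| <= 1/2] for every x, since [|f x| <= F]. *)
have F2_gt0 : 0 < (2 * (1 + F))^-1 by rewrite invr_gt0; lra.
near=> e.
have e_gt0 : 0 < e by near: e; exact: nbhs_right_gt.
have e_lt : e < (2 * (1 + F))^-1 by near: e; exact: nbhs_right_lt.
have ef x : `|e * f x| <= 2^-1.
  rewrite normrM gtr0_norm//.
  have fF : `|f x| <= F by rewrite /F (bigD1 x)//= lerDl sumr_ge0.
  rewrite (le_trans (ler_wpM2l (ltW e_gt0) fF))//.
  have : e * (2 * (1 + F)) < 1 by rewrite -ltr_pdivlMr ?div1r//; lra.
  lra.
have ub := DV_J_perturb _ r_ge0 mu_ge0 H0_max ef; rewrite -/L -/C in ub.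
rewrite ler_pdivlMl// ler_pdivrMl//; apply/andP; split.
  (* The lower bound tests the supremum at [H0]; [ub] shows that the supremum is finite, and then
     bounds it above. *)
  rewrite lerBrDl -DV_JD; apply: ub_le_sup; last by exists H0.
  by eexists => _ [H _ <-]; exact: ub.
rewrite lerBlDl; apply: ge_sup.
  by exists (DV_J r H0 (fun x => mu x + e * (mu x * f x))), H0.
by move=> _ [H _ <-]; rewrite (le_trans (ub H))//; lra.
Unshelve. all: by end_near. Qed.

(** * The stationary measure *)

Lemma stationary_gt0 r mu :
  jump_rates r -> irreducible_rates r -> is_prob mu -> stationary r mu ->
  forall x, 0 < mu x.
Proof.
move=> r_ge0 r_irr [mu_ge0 mu1] mu_stat z.
rewrite lt_def mu_ge0 andbT; apply/negP => /eqP mu_z0.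
suff mu0 x : mu x = 0.
  by move: mu1; rewrite big1// => /eqP; rewrite eq_sym oner_eq0.
(* Stationarity tested on the indicator of [b] says that the flow into [b] vanishes, so zeros of
   [mu] spread to predecessors and, by irreducibility, everywhere. *)
have mu0_pred a b : mu b = 0 -> 0 < r a b -> mu a = 0.
  move=> mub0 rab; have [->//|ab] := eqVneq a b.
  have sum0 : \sum_(c | c != b) mu c * r c b = 0.
    have := mu_stat (fun c => (c == b)%:R).
    rewrite (bigD1 b)//= mub0 mul0r add0r => stat.
    rewrite -[RHS]stat; apply: eq_bigr => c cb; congr (_ * _).
    rewrite /generator (bigD1 b)//= big1 ?addr0.
      by rewrite eqxx (negbTE cb) subr0 mulr1.
    by move=> d db; rewrite (negbTE cb) (negbTE db) subrr mulr0.
  have term_ge0 c : c != b -> 0 <= mu c * r c b.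
    by move=> cb; rewrite mulr_ge0 ?mu_ge0 ?r_ge0.
  have /eqP := psumr_eq0P term_ge0 sum0 ab.
  by rewrite mulf_eq0 (gt_eqF rab) orbF => /eqP.
have /connectP[s] := r_irr x z; elim: s x => [|c s IHs] x /=.
  by move=> _ <-.
by move=> /andP[rxc sP] zE; apply: mu0_pred rxc; exact: IHs.
Qed.

(* By stationarity J_H(mu) = - sum mu r [e^d - 1 - d] with d = H(y) - H(x). *)
Lemma stationary_max_cst r mu H :
  jump_rates r -> irreducible_rates r -> (forall x, 0 < mu x) ->
  stationary r mu -> 0 <= DV_J r H mu -> forall x y, H x = H y.
Proof.
move=> r_ge0 r_irr mu_gt0 mu_stat J_ge0.
pose G x y := mu x * r x y * (expR (H y - H x) - 1 - (H y - H x)).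
have G_ge0 x y : 0 <= G x y.
  rewrite /G; have [<-|xy] := eqVneq x y.
    by rewrite subrr expR0 !subrr mulr0.
  apply: mulr_ge0; first by apply: mulr_ge0; [exact: ltW|exact: r_ge0].
  by have := expR_ge1Dx (H y - H x); lra.
(* J and the sum of [G] are both nonnegative and add up to zero. *)
have G0 x y : G x y = 0.
  have JG : DV_J r H mu + \sum_x \sum_y G x y = 0.
    rewrite -[RHS]oppr0 -[X in _ = - X](mu_stat H) -sumrN DV_JE -big_split.
    apply: eq_bigr => a _ /=.
    rewrite mulr_sumr -sumrN -big_split; apply: eq_bigr => b _ /=.
    by rewrite /G; ring.
  apply/eqP; rewrite -normr_le0 (le_trans (@ler_norm_sum2 G x y))//.
  under eq_bigr do under eq_bigr do rewrite ger0_norm//.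
  by lra.
have edge a b : 0 < r a b -> H a = H b.
  move=> rab; have /eqP := G0 a b.
  rewrite mulf_eq0 gt_eqF ?mulr_gt0//= => /eqP E.
  (* Equality e^d = 1 + d holds only at d = 0. *)
  apply/esym/eqP; rewrite -subr_eq0; apply: contraT => /expR_gt1Dx; lra.
move=> x y; have /connectP[s] := r_irr x y.
elim: s x => [|c s IHs] x /=; first by move=> _ ->.
by move=> /andP[/edge -> sP] yE; exact: IHs.
Qed.

End RateFunctional.

Theorem lemma5p11 (R : realType) (V : finType) (r : V -> V -> R) (p : V -> R)
    (r_rates : jump_rates r) (r_irr : irreducible_rates r)
    (p_prob : is_prob p) (p_stat : stationary r p) :
  (forall mu f : V -> R,
     is_prob mu -> (forall x, 0 < mu x) -> \sum_x mu x * f x = 0 ->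
     let nu := fun x => mu x * f x in
     DV_I_derivative r mu nu
       (\sum_x \sum_y nu x * r x y * (1 - expR (DV_H r mu y - DV_H r mu x))))
  /\ (exists c : R, forall x, DV_H r p x = c)
  /\ (forall nu : V -> R, \sum_x nu x = 0 -> DV_I_derivative r p nu 0).
Proof.
have p_gt0 := stationary_gt0 r_rates r_irr p_prob p_stat.
have p_cst : forall x y, DV_H r p x = DV_H r p y.
  apply: (stationary_max_cst r_rates r_irr p_gt0 p_stat).
  by rewrite -(DV_J_cst r p 0) DV_H_max.
have derivative mu f : (forall x, 0 < mu x) ->
    let nu := fun x => mu x * f x in
    DV_I_derivative r mu nu (DV_J r (DV_H r mu) nu).
  move=> mu_gt0; apply: DV_I_derivativeE => // [x|H]; first exact: ltW.
  exact: DV_H_max.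
split=> [mu f _ mu_gt0 _ nu|]; first by rewrite -DV_JE; exact: derivative.
split=> [|nu _].
  have [x0 _|V0] := pickP (@predT V); last by exists 0 => x; have := V0 x.
  by exists (DV_H r p x0).
(* As [p] is positive, every [nu] has a density with respect to it. *)
have nuE : nu = fun x => p x * (nu x / p x).
  by apply/funext => x; rewrite mulrC divfK// gt_eqF.
have := derivative p (fun x => nu x / p x) p_gt0; rewrite /= -nuE.
rewrite DV_JE big1// => x _; rewrite big1// => y _.
by rewrite (p_cst x y) subrr expR0 subrr mulr0.
Qed.
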